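(* Let $A\in\mathbb{R}^{m\times n}$, $b\in\mathbb{R}^m$, and let $\kappa:\mathbb{R}^n\to(-\infty,+\infty]$ be a polyhedral gauge function, i.e. a nonnegative, positively homogeneous, convex function with $\kappa(0)=0$ that is convex piecewise linear (a polyhedral convex function: its epigraph is a polyhedral convex set). For $\mu\ge 0$ let $\Omega(\mu)\subseteq\mathbb{R}^n$ be the set of optimal solutions of the primal problem $\min_{x\in\mathbb{R}^n}\{\frac12\|Ax-b\|^2+\mu\kappa(x)\}$, and let $\xi(\mu)\in\mathbb{R}^m$ be the unique optimal solution of the dual problem $\max_{\xi\in\mathbb{R}^m}\{-\frac12\|\xi\|^2+\langle b,\xi\rangle \mid \kappa^\circ(A^T\xi)\le\mu\}$, where $\kappa^\circ$ is the polar of $\kappa$. Then: (i) for any $\mu\ge 0$, $\xi(\mu)=b-Ax$ for all $x\in\Omega(\mu)$, i.e. $\|b-Ax\|$ is invariant on the solution set $\Omega(\mu)$; (ii) for all $\mu\ge\mu_\infty:=\kappa^\circ(A^Tb)$, $\xi(\mu)=b$ and $0\in\Omega(\mu)$; (iii) $\xi$ is a piecewise affine function on its domain $\{\mu\in\mathbb{R} \mid \mu\ge0\}$; (iv) if $\mu_\infty>0$, then for any $0\le\mu_1<\mu_2\le\mu_\infty$ one has $\|\xi(\mu_1)\|<\|\xi(\mu_2)\|$, i.e. $\|b-Ax_1\|<\|b-Ax_2\|$ for all $x_1\in\Omega(\mu_1)$ and $x_2\in\Omega(\mu_2)$.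
   Context: $\|\cdot\|$ is the Euclidean norm. The polar of $\kappa$ is $\kappa^\circ(y):=\inf\{u\ge 0 \mid \langle x,y\rangle\le u\,\kappa(x)\ \ \forall x\in\mathbb{R}^n\}$. The domain of $\Omega$ and of $\xi$, as (multi-)functions of $\mu$, is $\{\mu\in\mathbb{R}\mid\mu\ge0\}$, and $\xi$ is single-valued there. A function on an interval is piecewise affine if it is continuous and the interval is a finite union of subintervals on each of which the function is affine.
   Formalization: Part (iv) is stated for finite μ_∞ (it fails if μ_∞=+∞, e.g. κ=0, A=I, b≠0, where ξ is identically 0), and at μ=0 the term μκ(x) is read as +∞ outside the domain of κ, since otherwise (i) can fail at μ=0. *)

(* Defs.v *)
From HB Require Import structures.
From mathcomp Require Export all_boot all_order all_algebra.
From mathcomp Require Export all_classical all_reals all_analysis.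
Export Order.TTheory GRing.Theory Num.Theory.
Export numFieldNormedType.Exports.

Set Implicit Arguments.
Unset Strict Implicit.
Unset Printing Implicit Defensive.

Local Open Scope classical_set_scope.
Local Open Scope ring_scope.

Definition dot (R : realType) (n : nat) (u v : 'cV[R]_n) : R :=
  \sum_(i < n) u i 0 * v i 0.

(* The library norm on matrices is the sup norm. *)
Definition enorm (R : realType) (n : nat) (u : 'cV[R]_n) : R :=
  Num.sqrt (dot u u).

(* Product of u >= 0 with a in ]-oo, +oo], with 0 * +oo = +oo (the library has
   0 * +oo = 0): u * kappa is +oo outside dom kappa, also for u = 0, so the
   problem with u = 0 keeps the implicit constraint x in dom kappa. *)
Definition escale (R : realType) (u : R) (a : \bar R) : \bar R :=
  if a == +oo%E then +oo%E else (u%:E * a)%E.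

Definition polyhedral (R : realType) (n : nat) (S : set 'cV[R]_n) : Prop :=
  exists (k : nat) (C : 'M[R]_(k, n)) (d : 'cV[R]_k),
    S = [set z | forall i, (C *m z) i 0 <= d i 0].

(* (x, t) in R^n x R is the column vector col_mx x t of R^(n + 1). *)
Definition epigraph (R : realType) (n : nat) (f : 'cV[R]_n -> \bar R) :
    set 'cV[R]_(n + 1) :=
  [set z | (f (usubmx z) <= (dsubmx z 0 0)%:E)%E].

Record polyhedral_gauge (R : realType) (n : nat)
    (kappa : 'cV[R]_n -> \bar R) : Prop := PolyhedralGauge {
  gauge_ge0 : forall x, (0 <= kappa x)%E;
  gauge0 : kappa 0 = 0%E;
  gauge_pos_homogeneous : forall (t : R) (x : 'cV[R]_n),
    0 < t -> kappa (t *: x) = (t%:E * kappa x)%E;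
  gauge_convex : forall (t : R) (x y : 'cV[R]_n), 0 < t -> t < 1 ->
    (kappa (t *: x + (1 - t) *: y)%R
       <= t%:E * kappa x + (1 - t)%R%:E * kappa y)%E;
  gauge_polyhedral : polyhedral (epigraph kappa)
}.

Definition polar (R : realType) (n : nat) (kappa : 'cV[R]_n -> \bar R)
    (y : 'cV[R]_n) : \bar R :=
  ereal_inf [set u%:E | u in
    [set u : R | 0 <= u /\ forall x, ((dot x y)%:E <= escale u (kappa x))%E]].

Section problems.
Variables (R : realType) (m n : nat).
Variables (A : 'M[R]_(m, n)) (b : 'cV[R]_m) (kappa : 'cV[R]_n -> \bar R).

Definition primal_obj (mu : R) (x : 'cV[R]_n) : \bar R :=
  ((2^-1 * enorm (A *m x - b) ^+ 2)%:E + escale mu (kappa x))%E.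

Definition Omega (mu : R) : set 'cV[R]_n :=
  [set x | forall y, (primal_obj mu x <= primal_obj mu y)%E].

Definition dual_obj (z : 'cV[R]_m) : R :=
  - (2^-1 * enorm z ^+ 2) + dot b z.

Definition dual_feasible (mu : R) : set 'cV[R]_m :=
  [set z | (polar kappa (A^T *m z) <= mu%:E)%E].

Definition dual_solutions (mu : R) : set 'cV[R]_m :=
  [set z | dual_feasible mu z /\
           forall w, dual_feasible mu w -> dual_obj w <= dual_obj z].

(* The default value 0 is used only if there is no dual solution. *)
Definition xi (mu : R) : 'cV[R]_m := xget 0 (dual_solutions mu).

Definition mu_infty : \bar R := polar kappa (A^T *m b).

End problems.

Definition affine_on (R : realType) (m : nat) (D : set R)
    (f : R -> 'cV[R]_m) : Prop :=
  exists p q : 'cV[R]_m, forall t, D t -> f t = p + t *: q.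

Definition piecewise_affine (R : realType) (m : nat) (I : interval R)
    (f : R -> 'cV[R]_m) : Prop :=
  {within [set` I], continuous f} /\
  exists s : seq (interval R),
    [set` I] = \bigcup_(J in [set` s]) [set` J] /\
    forall J, J \in s -> affine_on [set` J] f.

(* Main.v *)
(** The epigraph of kappa is a polyhedral cone, so the primal problem minimizes
    1/2 |A x - b|^2 + mu t over a finite system of homogeneous inequalities in
    w = (x, t), and has a solution by the Frank-Wolfe theorem.  The residual
    r = b - A x of a solution satisfies <A y, r> <= mu s on the epigraph, with
    equality at w; hence r is the projection of b on the dual feasible set.

    For each set J of inequalities, the first-order condition for optimality at
    a point where the inequalities of J are active is jointly convex in
    (mu, w).  So the parameters for which J serves form an interval on which r
    is affine, and these finitely many intervals cover [0, +oo[.  Continuity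
    follows from |r_s - r_t|^2 <= (s - t) (kappa x_t - kappa x_s), where
    kappa x_s is bounded by kappa x_0.

    Finally |r_2|^2 >= |r_1|^2 + 2 mu_1 (kappa x_1 - kappa x_2) + |r_1 - r_2|^2,
    and r_1 = r_2 forces kappa x_2 = 0 and <A x_2, r_2> = 0, so that
    |A x_2|^2 = <A x_2, b> <= mu_oo kappa x_2 = 0: then r_1 = b, and b would be
    feasible below mu_oo. *)

Require Import Defs.
From mathcomp Require Import ring lra.

Set Implicit Arguments.
Unset Strict Implicit.
Unset Printing Implicit Defensive.

Local Open Scope classical_set_scope.
Local Open Scope ring_scope.

(** * Euclidean inner product *)

Section dot_product.
Variable R : realType.

Lemma dot_trmx n (u v : 'cV[R]_n) : dot u v = (u^T *m v) 0 0.
Proof. by rewrite mxE; apply: eq_bigr => i _; rewrite mxE. Qed.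

Lemma dotC n (u v : 'cV[R]_n) : dot u v = dot v u.
Proof. by apply: eq_bigr => i _; rewrite mulrC. Qed.

Lemma dotDr n (u v w : 'cV[R]_n) : dot u (v + w) = dot u v + dot u w.
Proof. by rewrite !dot_trmx mulmxDr mxE. Qed.

Lemma dotZr n a (u v : 'cV[R]_n) : dot u (a *: v) = a * dot u v.
Proof. by rewrite !dot_trmx -scalemxAr mxE. Qed.

Lemma dotNr n (u v : 'cV[R]_n) : dot u (- v) = - dot u v.
Proof. by rewrite -scaleN1r dotZr mulN1r. Qed.

Lemma dotBr n (u v w : 'cV[R]_n) : dot u (v - w) = dot u v - dot u w.
Proof. by rewrite dotDr dotNr. Qed.

Lemma dotDl n (u v w : 'cV[R]_n) : dot (u + v) w = dot u w + dot v w.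
Proof. by rewrite dotC dotDr !(dotC w). Qed.

Lemma dotZl n a (u v : 'cV[R]_n) : dot (a *: u) v = a * dot u v.
Proof. by rewrite dotC dotZr dotC. Qed.

Lemma dotNl n (u v : 'cV[R]_n) : dot (- u) v = - dot u v.
Proof. by rewrite dotC dotNr dotC. Qed.

Lemma dotBl n (u v w : 'cV[R]_n) : dot (u - v) w = dot u w - dot v w.
Proof. by rewrite dotDl dotNl. Qed.

Lemma dot0r n (u : 'cV[R]_n) : dot u 0 = 0.
Proof. by rewrite -(scale0r u) dotZr mul0r. Qed.

Lemma dot0l n (u : 'cV[R]_n) : dot 0 u = 0.
Proof. by rewrite dotC dot0r. Qed.

Lemma dot_mulmxl m n (A : 'M[R]_(m, n)) u v :
  dot (A *m u) v = dot u (A^T *m v).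
Proof. by rewrite !dot_trmx trmx_mul mulmxA. Qed.

Lemma dot_ge0 n (u : 'cV[R]_n) : 0 <= dot u u.
Proof. by apply: sumr_ge0 => i _; rewrite -expr2 sqr_ge0. Qed.

Lemma sqr_coord_le_dot n (u : 'cV[R]_n) i : u i 0 ^+ 2 <= dot u u.
Proof.
rewrite /dot (bigD1 i) //= -expr2 lerDl.
by apply: sumr_ge0 => j _; rewrite -expr2 sqr_ge0.
Qed.

Lemma dot_eq0 n (u : 'cV[R]_n) : dot u u <= 0 -> u = 0.
Proof.
move=> u0; apply/matrixP => i j; rewrite ord1 mxE.
apply/eqP; rewrite -sqrf_eq0 eq_le sqr_ge0 andbT.
exact: le_trans (sqr_coord_le_dot u i) u0.
Qed.

Lemma enorm_sqr n (u : 'cV[R]_n) : enorm u ^+ 2 = dot u u.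
Proof. by rewrite sqr_sqrtr// dot_ge0. Qed.

End dot_product.

Definition dotE := (dotDl, dotDr, dotNl, dotNr, dotZl, dotZr).

(** * Convex quadratic programs over polyhedral cones *)

Section quadratic_program.
Variable R : realType.

Definition qp_obj m n (B : 'M[R]_(m, n)) (b : 'cV[R]_m) (c w : 'cV[R]_n) : R :=
  2^-1 * dot (B *m w - b) (B *m w - b) + dot c w.

Lemma qp_obj_line m n (B : 'M[R]_(m, n)) b c w v a :
  qp_obj B b c (w + a *: v) = qp_obj B b c w
    + a * (dot (B *m w - b) (B *m v) + dot c v)
    + a ^+ 2 * (2^-1 * dot (B *m v) (B *m v)).
Proof.
rewrite /qp_obj mulmxDr -scalemxAr addrAC.
move: (B *m w - b) (B *m v) => r s.
by rewrite !dotE (dotC s r); field.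
Qed.

Lemma qp_obj_ray m n (B : 'M[R]_(m, n)) b c w v a :
  B *m v = 0 -> dot c v < 0 -> 0 <= a ->
  qp_obj B b c (w + a *: v) <= qp_obj B b c w.
Proof. by move=> Bv cv a0; rewrite qp_obj_line Bv !dot0r; nra. Qed.

Lemma qp_obj_segment m n (B : 'M[R]_(m, n)) b c w v a :
  qp_obj B b c v <= qp_obj B b c w -> 0 <= a -> a <= 1 ->
  qp_obj B b c (w + a *: (v - w)) <= qp_obj B b c w.
Proof.
rewrite -[in X in X -> _](subrKC w v) -(scale1r (v - w)) !qp_obj_line scale1r.
move=> le_vw a0 a1; have g0 := dot_ge0 (B *m (v - w)).
have : 0 <= a * (1 - a) * dot (B *m (v - w)) (B *m (v - w)).
  by rewrite !mulr_ge0// subr_ge0.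
nra.
Qed.

(** Equalities are kept apart from inequalities so that induction on [s] can turn an inequality into
    an equality. *)
Definition qp_cone n p (E : 'M[R]_(p, n)) (s : seq 'cV[R]_n) : set 'cV[R]_n :=
  [set w | E *m w = 0 /\ forall r, r \in s -> dot r w <= 0].

(** Fredholm alternative: a [g] outside the row space of [M], which is its range by symmetry, has
    nonzero product with some column of the cokernel, a kernel vector whose sign is free. *)
Lemma symmetric_solvable n (M : 'M[R]_n) (g : 'cV[R]_n) : M^T = M ->
  (exists y, M *m y = g) \/ (exists2 v, M *m v = 0 & dot g v < 0).
Proof.
move=> sM; have [/submxP[D gD]|] := boolP (g^T <= M)%MS.
  by left; exists D^T; rewrite -[in LHS]sM -trmx_mul -gD trmxK.
rewrite submxE => gN0; right.
have [j gj] : exists j, (g^T *m cokermx M) 0 j != 0.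
  apply/existsP; apply: contraNT gN0; rewrite negb_exists => /forallP g0.
  by apply/eqP/matrixP => i j; rewrite ord1 [RHS]mxE; apply/eqP/negPn/g0.
have E : dot g (col j (cokermx M)) = (g^T *m cokermx M) 0 j.
  by rewrite dot_trmx colE mulmxA -colE mxE.
have M0 : M *m col j (cokermx M) = 0 by rewrite colE mulmxA mulmx_coker mul0mx.
move: gj; rewrite neq_lt => /orP[gj|gj].
  by exists (col j (cokermx M)); rewrite ?E.
exists (- col j (cokermx M)); first by rewrite mulmxN M0 oppr0.
by rewrite dotNr E oppr_lt0.
Qed.

(* Frank-Wolfe for convex objectives.  Dropping an inequality r, the relaxed
   problem has either a minimizer or a descent ray; unless it already serves,
   moving towards it from any feasible point meets the hyperplane r = 0 without
   increasing the objective, so that the problem reduces to that face. *)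
Lemma qp_cone_attained m n (B : 'M[R]_(m, n)) b c s p (E : 'M[R]_(p, n)) :
  (exists2 w, qp_cone E s w &
     forall v, qp_cone E s v -> qp_obj B b c w <= qp_obj B b c v) \/
  (exists v, [/\ qp_cone E s v, B *m v = 0 & dot c v < 0]).
Proof.
elim: s p E => [|r s IH] p E.
  (* [U] parametrizes the kernel of [E]; the problem in [y] is unconstrained and its normal equation
     has the matrix [BU^T *m BU]. *)
  pose U := (kermx E^T)^T; pose BU := B *m U.
  have inU w : E *m w = 0 -> exists y, w = U *m y.
    move=> Ew; have : (w^T <= kermx E^T)%MS.
      by apply/sub_kermxP; rewrite -trmx_mul Ew trmx0.
    by move=> /submxP[D wD]; exists D^T; rewrite -trmx_mul -wD trmxK.
  have EU y : E *m (U *m y) = 0.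
    by rewrite mulmxA -{1}(trmxK E) -trmx_mul mulmx_ker trmx0 mul0mx.
  have sM : (BU^T *m BU)^T = BU^T *m BU by rewrite trmx_mul trmxK.
  have [[y yE]|[v vE cv]] := symmetric_solvable (BU^T *m b - U^T *m c) sM.
    left; exists (U *m y); first by split.
    move=> v [/inU[z ->] _].
    rewrite -(subrKC y z) mulmxDr -[U *m (z - y)]scale1r qp_obj_line mulmxA.
    rewrite -/BU mulmxA -/BU.
    have -> : dot (BU *m y - b) (BU *m (z - y)) + dot c (U *m (z - y)) = 0.
      rewrite [X in X + _]dotC [X in _ + X]dotC !dot_mulmxl -dotDr mulmxBr.
      by rewrite mulmxA yE addrAC subrK subrr dot0r.
    by have := dot_ge0 (BU *m (z - y)); lra.
  have BUv : BU *m v = 0.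
    by apply: dot_eq0; rewrite dot_mulmxl mulmxA vE dot0r.
  right; exists (- (U *m v)); split; first by split; rewrite // mulmxN EU oppr0.
    by rewrite mulmxN mulmxA BUv oppr0.
  move: cv; rewrite dotBl !dot_mulmxl !trmxK -/BU BUv dot0r.
  by rewrite dotNr; lra.
have reduce : (forall w, qp_cone E (r :: s) w ->
    exists2 u, qp_cone (col_mx E r^T) s u & qp_obj B b c u <= qp_obj B b c w) ->
  (exists2 w, qp_cone E (r :: s) w &
     forall v, qp_cone E (r :: s) v -> qp_obj B b c w <= qp_obj B b c v) \/
  (exists v, [/\ qp_cone E (r :: s) v, B *m v = 0 & dot c v < 0]).
  move=> face.
  have sub w : qp_cone (col_mx E r^T) s w -> qp_cone E (r :: s) w.
    move=> [Ew sw]; move: Ew; rewrite mul_col_mx -[RHS]col_mx0.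
    move=> /eq_col_mx[Ew rw]; split=> // q; rewrite in_cons => /predU1P[->|/sw//].
    by rewrite dot_trmx rw mxE.
  have [[w ws wmin]|[v [vs Bv cv]]] := IH _ (col_mx E r^T).
    left; exists w; first exact: sub.
    by move=> v /face[u us]; apply: le_trans; apply: wmin.
  by right; exists v; split=> //; apply: sub.
have on_face w v a : qp_cone E (r :: s) w -> E *m v = 0 ->
    (forall q, q \in s -> dot q (w + a *: v) <= 0) ->
    dot r (w + a *: v) = 0 -> qp_cone (col_mx E r^T) s (w + a *: v).
  move=> [Ew _] Ev sv rv; split=> //.
  rewrite mul_col_mx mulmxDr -scalemxAr Ew Ev scaler0 addr0.
  rewrite -[RHS]col_mx0; congr col_mx.
  by apply/matrixP => i j; rewrite !ord1 -dot_trmx rv mxE.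
have [[w0 [Ew0 sw0] w0min]|[v [[Ev sv] Bv cv]]] := IH _ E.
  have [rw0|rw0] := lerP (dot r w0) 0.
    left; exists w0.
      by split=> // q; rewrite in_cons => /predU1P[->|/sw0].
    move=> v [Ev sv]; apply: w0min; split=> // q qs.
    by apply: sv; rewrite in_cons qs orbT.
  apply: reduce => w [Ew sw].
  have rw : dot r w <= 0 by apply: sw; rewrite mem_head.
  have swl q : q \in s -> dot q w <= 0.
    by move=> qs; apply: sw; rewrite in_cons qs orbT.
  have d_gt0 : 0 < dot r w0 - dot r w by lra.
  pose a := - dot r w / (dot r w0 - dot r w).
  have a0 : 0 <= a by rewrite divr_ge0 ?oppr_ge0// ltW.
  have a1 : a <= 1 by rewrite ler_pdivrMr// mul1r; lra.
  exists (w + a *: (w0 - w)).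
    apply: on_face => //; first by rewrite mulmxBr Ew Ew0 subr0.
      by move=> q qs; rewrite !dotE; have := swl q qs; have := sw0 q qs; nra.
    by rewrite !dotE /a; field; rewrite gt_eqF.
  by apply: qp_obj_segment => //; apply: w0min.
have [rv|rv] := lerP (dot r v) 0.
  right; exists v; split=> //.
  by split=> // q; rewrite in_cons => /predU1P[->|/sv].
apply: reduce => w [Ew sw].
have rw : dot r w <= 0 by apply: sw; rewrite mem_head.
pose a := - dot r w / dot r v.
have a0 : 0 <= a by rewrite divr_ge0 ?oppr_ge0// ltW.
exists (w + a *: v); last exact: qp_obj_ray.
apply: on_face => //.
  move=> q qs; rewrite !dotE.
  have : dot q w <= 0 by apply: sw; rewrite in_cons qs orbT.
  by have := sv q qs; nra.
by rewrite !dotE /a; field; rewrite gt_eqF.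
Qed.

End quadratic_program.

(** * Polar and epigraph of a polyhedral gauge *)

Section gauge.
Variables (R : realType) (n : nat) (kappa : 'cV[R]_n -> \bar R).
Hypothesis hkappa : polyhedral_gauge kappa.

Lemma gauge_cases x :
  kappa x = +oo%E \/ exists2 k, kappa x = k%:E & 0 <= k.
Proof.
have := gauge_ge0 hkappa x.
by case: (kappa x) => [k k0|_|] //; [right; exists k | left].
Qed.

Lemma gauge_le_ge0 x t : (kappa x <= t%:E)%E -> 0 <= t.
Proof. by move=> xt; rewrite -lee_fin (le_trans _ xt)// gauge_ge0. Qed.

(** Quantifying over epigraph points keeps the arithmetic real. The bound passes to the infimum
    because each inequality survives letting [u] decrease to [mu]. *)
Lemma polar_leP y mu : (polar kappa y <= mu%:E)%E <->
  0 <= mu /\ forall x t, (kappa x <= t%:E)%E -> dot x y <= mu * t.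
Proof.
split=> [ymu|[mu0 ymu]]; last first.
  apply: ereal_inf_lbound; exists mu => //; split=> // x; rewrite /escale.
  have [->|[k kx _]] := gauge_cases x; first by rewrite eqxx leey.
  by rewrite kx /= -EFinM lee_fin ymu// kx.
split.
  rewrite -lee_fin (le_trans _ ymu)//; apply: le_ereal_inf_tmp.
  by move=> _ [u [u0 _] <-]; rewrite lee_fin.
move=> x t xt; have t0 := gauge_le_ge0 xt; apply/ler_addgt0Pr => e e0.
have t1 : 0 < t + 1 by rewrite ltr_wpDl.
(* The slack [e / (t + 1)] costs at most [e] once multiplied by [t], also when [t = 0]. *)
have : (polar kappa y < (mu + e / (t + 1))%:E)%E.
  by rewrite (le_lt_trans ymu)// lte_fin ltrDl divr_gt0.
move=> /ereal_inf_lt[_ [u [u0 /(_ x) xu] <-]]; rewrite lte_fin => uE.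
have [kx|[k kx k0]] := gauge_cases x; first by rewrite kx in xt.
move: xu; rewrite /escale kx /= -EFinM lee_fin => /le_trans; apply.
have kt : k <= t by rewrite kx lee_fin in xt.
have : e / (t + 1) * t <= e.
  by rewrite mulrAC ler_pdivrMr// ler_wpM2l// ?(ltW e0)// lerDl.
have : 0 < e / (t + 1) by rewrite divr_gt0.
move: (e / (t + 1)) uE => d; nra.
Qed.

(** Scaling up an epigraph point with a positive constraint value would exceed the bound [d]; since
    0 is in the epigraph, [d] is nonnegative. So [d] can be replaced by 0. *)
Lemma epigraph_cone : exists k (C : 'M[R]_(k, n + 1)), forall w,
  epigraph kappa w <-> forall i, (C *m w) i 0 <= 0.
Proof.
have [k [C [d epiE]]] := gauge_polyhedral hkappa.
exists k, C => w; split=> [wepi i|Cw].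
  rewrite leNgt; apply/negP => Cwi.
  pose s := (`|d i 0| + 1) / (C *m w) i 0.
  have s0 : 0 < s by rewrite divr_gt0// ltr_wpDl.
  have : epigraph kappa (s *: w).
    rewrite /epigraph /= !linearZ /= [in leRHS]mxE gauge_pos_homogeneous//.
    by move: s s0 => s s0; rewrite EFinM lee_pmul2l.
  rewrite epiE => /(_ i); rewrite -scalemxAr mxE divfK ?gt_eqF//.
  have := ler_norm (d i 0); lra.
have : epigraph kappa 0.
  by rewrite /epigraph /= !linear0 mxE gauge0.
rewrite epiE /= => d0 i.
by apply: le_trans (Cw i) _; have := d0 i; rewrite mulmx0 mxE.
Qed.

End gauge.

(** * KKT points: optimality, uniqueness and comparison of residuals *)

Section saddle_points.
Variables (R : realType) (m n : nat).
Variables (A : 'M[R]_(m, n)) (b : 'cV[R]_m) (kappa : 'cV[R]_n -> \bar R).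
Hypothesis hkappa : polyhedral_gauge kappa.

Lemma dual_feasibleP mu z : dual_feasible A kappa mu z <->
  0 <= mu /\
  forall x t, (kappa x <= t%:E)%E -> dot (A *m x) z <= mu * t.
Proof.
rewrite /dual_feasible /= (polar_leP hkappa); split=> -[mu0 H].
  by split=> // x t; rewrite dot_mulmxl; apply: H.
by split=> // x t; rewrite -dot_mulmxl; apply: H.
Qed.

(* The KKT conditions, with t in the role of kappa x; for mu = 0 only
   kappa x <= t is required. *)
Definition saddle (mu : R) (x : 'cV[R]_n) (t : R) : Prop :=
  [/\ (kappa x <= t%:E)%E, dual_feasible A kappa mu (b - A *m x) &
      dot (A *m x) (b - A *m x) = mu * t].

Lemma saddle_ge0 mu x t : saddle mu x t -> 0 <= mu.
Proof. by case=> _ /dual_feasibleP[]. Qed.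

(** Strong concavity: away from the residual the dual objective falls by at least half the squared
    distance, as feasible [w] satisfy [<A x, w> <= mu t = <A x, b - A x>]. *)
Lemma saddle_dual_solutions mu x t : saddle mu x t ->
  dual_solutions A b kappa mu = [set b - A *m x].
Proof.
move=> [xt rfeas rx].
have gap w : dual_feasible A kappa mu w ->
    2^-1 * dot (w - (b - A *m x)) (w - (b - A *m x)) <=
    dual_obj b (b - A *m x) - dual_obj b w.
  move=> /dual_feasibleP[_ /(_ _ _ xt)].
  rewrite -rx /dual_obj !enorm_sqr; move: (A *m x) => a.
  rewrite !dotE (dotC w b) (dotC w a) (dotC a b); lra.
apply/seteqP; split=> [z [zfeas zmax]|_ ->] /=.
  apply/eqP; rewrite -subr_eq0; apply/eqP/dot_eq0.
  by have := gap _ zfeas; have := zmax _ rfeas; lra.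
split=> // w /gap; have := dot_ge0 (w - (b - A *m x)); lra.
Qed.

Lemma saddle_xi mu x t : saddle mu x t -> xi A b kappa mu = b - A *m x.
Proof.
move=> /saddle_dual_solutions E; rewrite /xi E.
by apply: xget_unique.
Qed.

(** Quadratic growth of the lifted primal objective; it forces all minimizers to share [A x]. *)
Lemma saddle_gap mu x t y s : saddle mu x t -> (kappa y <= s%:E)%E ->
  2^-1 * dot (A *m (y - x)) (A *m (y - x)) <=
  (2^-1 * dot (A *m y - b) (A *m y - b) + mu * s)
  - (2^-1 * dot (A *m x - b) (A *m x - b) + mu * t).
Proof.
move=> [xt /dual_feasibleP[_ rfeas] <-] /rfeas.
rewrite mulmxBr; move: (A *m x) (A *m y) => u v.
rewrite !dotE (dotC v u) (dotC v b) (dotC u b); lra.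
Qed.

Lemma primal_obj_fin mu x k : kappa x = k%:E ->
  primal_obj A b kappa mu x =
  (2^-1 * dot (A *m x - b) (A *m x - b) + mu * k)%:E.
Proof.
by move=> kx; rewrite /primal_obj /escale kx /= enorm_sqr EFinD -EFinM.
Qed.

Lemma primal_obj_infty mu x : kappa x = +oo%E ->
  primal_obj A b kappa mu x = +oo%E.
Proof. by move=> kx; rewrite /primal_obj /escale kx eqxx addey. Qed.

Lemma saddle_Omega mu x t : saddle mu x t -> Omega A b kappa mu x.
Proof.
move=> sad y; have mu0 := saddle_ge0 sad; have [xt _ _] := sad.
have [ky|[s ky s0]] := gauge_cases hkappa y.
  by rewrite (primal_obj_infty _ ky) leey.
have [kx|[k kx k0]] := gauge_cases hkappa x; first by rewrite kx in xt.
rewrite (primal_obj_fin _ kx) (primal_obj_fin _ ky) lee_fin.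
have kt : k <= t by rewrite kx lee_fin in xt.
have := @saddle_gap _ _ _ y s sad; rewrite ky lexx => /(_ isT).
have := dot_ge0 (A *m (y - x)); nra.
Qed.

Lemma Omega_saddle mu x x0 t0 : saddle mu x0 t0 -> Omega A b kappa mu x ->
  exists t, saddle mu x t.
Proof.
move=> sad0 /(_ x0) xx0; have mu0 := saddle_ge0 sad0.
have [xt0 rfeas rx0] := sad0.
have [kx0|[k0 kx0 k00]] := gauge_cases hkappa x0; first by rewrite kx0 in xt0.
have [kx|[k kx k_ge0]] := gauge_cases hkappa x.
  by rewrite (primal_obj_infty _ kx) (primal_obj_fin _ kx0) in xx0.
rewrite (primal_obj_fin _ kx) (primal_obj_fin _ kx0) lee_fin in xx0.
have k0t : k0 <= t0 by rewrite kx0 lee_fin in xt0.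
have := @saddle_gap _ _ _ x k sad0; rewrite kx lexx => /(_ isT) gap.
have Ax : A *m x = A *m x0.
  apply/eqP; rewrite -subr_eq0 -mulmxBr; apply/eqP/dot_eq0; nra.
(* The height is [kappa x] itself: for [mu = 0], [t0] need not bound it. *)
exists k; rewrite /saddle kx Ax; split=> //.
have /dual_feasibleP[_ /(_ x k)] := rfeas; rewrite kx lexx => /(_ isT).
rewrite Ax rx0 => le1; apply/eqP; rewrite eq_le le1 /=.
by move: xx0; rewrite Ax; nra.
Qed.

(** Each residual is feasible, so it can be tested at the other point; both inequalities and both
    complementarity equations add up to the bound. *)
Lemma saddle_residual_dist s x t s' x' t' : saddle s x t -> saddle s' x' t' ->
  dot (xi A b kappa s - xi A b kappa s') (xi A b kappa s - xi A b kappa s')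
    <= (s - s') * (t' - t).
Proof.
move=> sad sad'; rewrite (saddle_xi sad) (saddle_xi sad').
have [xt /dual_feasibleP[_ feas] rx] := sad.
have [xt' /dual_feasibleP[_ feas'] rx'] := sad'.
move: (feas _ _ xt') (feas' _ _ xt) rx rx'.
move: (A *m x) (A *m x') => u v.
rewrite !dotE (dotC v u) (dotC v b) (dotC u b); lra.
Qed.

Lemma saddle_antitone s x t s' x' t' : saddle s x t -> saddle s' x' t' ->
  s < s' -> t' <= t.
Proof.
move=> sad sad' ss'; have := saddle_residual_dist sad sad'.
have := dot_ge0 (xi A b kappa s - xi A b kappa s'); nra.
Qed.

Lemma saddle_norm_lt mu1 x1 t1 mu2 x2 t2 :
  saddle mu1 x1 t1 -> saddle mu2 x2 t2 -> mu1 < mu2 ->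
  (mu2%:E <= mu_infty A b kappa)%E -> (mu_infty A b kappa < +oo)%E ->
  enorm (b - A *m x1) < enorm (b - A *m x2).
Proof.
move=> sad1 sad2 mu12 mu2oo oofin.
have mu1_ge0 := saddle_ge0 sad1; have t21 := saddle_antitone sad1 sad2 mu12.
have [xt1 /dual_feasibleP[_ feas1] rx1] := sad1.
have [xt2 /dual_feasibleP[_ feas2] rx2] := sad2.
have t2_ge0 := gauge_le_ge0 hkappa xt2.
rewrite ltNge; apply/negP => le21.
have {le21} : dot (b - A *m x2) (b - A *m x2) <= dot (b - A *m x1) (b - A *m x1).
  by rewrite -!enorm_sqr ler_sqr// nnegrE sqrtr_ge0.
have := dot_ge0 (A *m x1 - A *m x2).
have r12 := feas1 _ _ xt2.
have Adiff : dot (b - A *m x2) (b - A *m x2) =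
    dot (b - A *m x1) (b - A *m x1)
    + 2 * (dot (A *m x1) (b - A *m x1) - dot (A *m x2) (b - A *m x1))
    + dot (A *m x1 - A *m x2) (A *m x1 - A *m x2).
  move: (A *m x1) (A *m x2) => u v.
  by rewrite !dotE (dotC v u) (dotC v b) (dotC u b); ring.
rewrite Adiff rx1 => d0 le21.
have Ax : A *m x1 = A *m x2.
  by apply/eqP; rewrite -subr_eq0; apply/eqP/dot_eq0; nra.
(* Equal residuals give [mu2 t2 = mu1 t1 <= mu1 t2], while [mu1 < mu2] and [0 <= t2]. *)
have t2_eq0 : t2 = 0.
  move: r12; rewrite -Ax rx1 => r12; move: rx2; rewrite -Ax rx1 => rx2.
  nra.
(* [mu_infty] is finite and nonnegative here, so [fine] returns its true value. *)
have bfeas : (polar kappa (A^T *m b) <= (fine (mu_infty A b kappa))%:E)%E.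
  by rewrite fineK// ge0_fin_numE// (le_trans _ mu2oo)// lee_fin; lra.
have /dual_feasibleP[_ /(_ _ _ xt2)] := bfeas.
rewrite t2_eq0 mulr0 => Axb.
have Ax2 : A *m x2 = 0.
  apply: dot_eq0; move: rx2; rewrite t2_eq0 mulr0 dotBr; lra.
have : (mu_infty A b kappa <= mu1%:E)%E.
  by have [_ + _] := sad1; rewrite Ax Ax2 subr0.
by move=> /(le_trans mu2oo); rewrite lee_fin leNgt mu12.
Qed.

End saddle_points.

(** * Active sets and the pieces on which the residual is affine *)

Section pieces.
Variables (R : realType) (m n : nat).
Variables (A : 'M[R]_(m, n)) (b : 'cV[R]_m) (kappa : 'cV[R]_n -> \bar R).
Hypothesis hkappa : polyhedral_gauge kappa.
Variables (k : nat) (C : 'M[R]_(k, n + 1)).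
Hypothesis epiC : forall w,
  epigraph kappa w <-> forall i, (C *m w) i 0 <= 0.

(* The first-order optimality condition on the cone of directions that are
   feasible for the constraints in J, all of which are active at w. *)
Definition kkt (J : {set 'I_k}) (mu : R) (w : 'cV[R]_(n + 1)) : Prop :=
  [/\ forall i, (C *m w) i 0 <= 0, forall i, i \in J -> (C *m w) i 0 = 0 &
      forall v, (forall i, i \in J -> (C *m v) i 0 <= 0) ->
        dot (A *m usubmx v) (b - A *m usubmx w) <= mu * dsubmx v 0 0].

(** The constraints in [J] are active at [v], so both [v] and [- v] are admissible directions at
    [w]; this gives equality across different parameters. *)
Lemma kkt_complementary J mu w nu v : kkt J mu w -> kkt J nu v ->
  dot (A *m usubmx v) (b - A *m usubmx w) = mu * dsubmx v 0 0.
Proof.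
move=> [_ _ H] [_ Cv _]; apply/eqP; rewrite eq_le.
apply/andP; split; first by apply: H => i /Cv ->.
have := H (- v); rewrite !linearN /= dotNl mxE mulrN lerN2; apply=> i /Cv.
by move=> Cvi; rewrite [leLHS]mxE Cvi oppr0.
Qed.

Lemma kkt_saddle J mu w : 0 <= mu -> kkt J mu w ->
  saddle A b kappa mu (usubmx w) (dsubmx w 0 0).
Proof.
move=> mu0 K; have [Cw _ H] := K.
split; [exact/epiC | | exact: (kkt_complementary K K)].
apply/(dual_feasibleP A hkappa); split=> // y s ys.
have := H (col_mx y s%:M); rewrite col_mxKu col_mxKd mxE eqxx mulr1n.
apply=> i _; suff /epiC : epigraph kappa (col_mx y s%:M) by apply.
by rewrite /epigraph /= col_mxKu col_mxKd mxE eqxx mulr1n.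
Qed.

(** [J] collects the constraints active at a minimizer of the lifted program; a direction violating
    the first-order condition would allow a small feasible step of descent. *)
Lemma kkt_exists mu : 0 <= mu -> exists J w, kkt J mu w.
Proof.
move=> mu0.
pose B : 'M[R]_(m, n + 1) := row_mx A 0.
pose c : 'cV[R]_(n + 1) := col_mx 0 mu%:M.
pose s := [seq (row i C)^T | i <- enum 'I_k].
have BE w : B *m w = A *m usubmx w.
  by rewrite -[w in LHS]vsubmxK mul_row_col mul0mx addr0.
have cE w : dot c w = mu * dsubmx w 0 0.
  rewrite -[w in LHS]vsubmxK dot_trmx tr_col_mx mul_row_col trmx0 mul0mx add0r.
  by rewrite tr_scalar_mx mul_scalar_mx mxE.
have sE w : qp_cone (0 : 'M[R]_(0, n + 1)) s w <-> forall i, (C *m w) i 0 <= 0.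
  have dotC_row i : dot (row i C)^T w = (C *m w) i 0.
    by rewrite dot_trmx trmxK -row_mul mxE.
  split=> [[_ sw] i|Cw].
    by rewrite -dotC_row; apply: sw; apply/mapP; exists i; rewrite ?mem_enum.
  split; first by rewrite mul0mx.
  by move=> _ /mapP[i _ ->]; rewrite dotC_row.
have [[w /sE Cw wmin]|[v [/sE Cv Bv]]] :=
    qp_cone_attained B b c s (0 : 'M[R]_(0, n + 1)); last first.
  (* A descent ray would have a negative height, but [kappa] is nonnegative. *)
  have /epiC/(gauge_le_ge0 hkappa) := Cv.
  by rewrite cE => v0 cv; have := mulr_ge0 mu0 v0; lra.
exists [set i | (C *m w) i 0 == 0]%SET, w; split=> //.
  by move=> i; rewrite inE => /eqP.
move=> v Cv; rewrite leNgt; apply/negP => slope.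
pose S := \sum_i `|(C *m v) i 0| / `|(C *m w) i 0|.
pose g := 2^-1 * dot (A *m usubmx v) (A *m usubmx v).
pose d := dot (A *m usubmx v) (b - A *m usubmx w) - mu * dsubmx v 0 0.
have d0 : 0 < d by rewrite subr_gt0.
have g0 : 0 <= g by rewrite mulr_ge0// dot_ge0.
have S0 : 0 <= S by apply: sumr_ge0 => i _; rewrite divr_ge0.
(* The step length: [e * S <= 1] preserves the inactive constraints (active ones add 0 to [S],
   division by 0 being 0), and [e * (g / d) < 1] keeps the quadratic term [e ^+ 2 * g] below the
   linear gain [e * d]. *)
pose e := (1 + S + g / d)^-1.
have gd0 : 0 <= g / d by rewrite divr_ge0// ltW.
have e0 : 0 < e by rewrite invr_gt0; lra.
have e1 : e * (1 + S + g / d) = 1 by rewrite mulVf// gt_eqF//; lra.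
have : qp_cone (0 : 'M[R]_(0, n + 1)) s (w + e *: v).
  apply/sE => i; rewrite mulmxDr -scalemxAr mxE [X in _ + X]mxE.
  have [Cw0|Cw0] := eqVneq ((C *m w) i 0) 0.
    by rewrite Cw0 add0r mulr_ge0_le0 ?(ltW e0)// Cv// inE Cw0.
  have : `|(C *m v) i 0| / `|(C *m w) i 0| <= S.
    rewrite /S (bigD1 i)//= lerDl.
    by apply: sumr_ge0 => j _; rewrite divr_ge0.
  have nCw0 : 0 < `|(C *m w) i 0| by rewrite normr_gt0.
  rewrite ler_pdivrMr// => leS.
  have := ler_norm ((C *m v) i 0).
  move: leS nCw0; rewrite (ler0_norm (Cw i)) => leS nCw0 leC.
  have : e * S <= 1 by nra.
  nra.
move=> /wmin; rewrite qp_obj_line -addrA lerDl !BE cE -/g.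
have -> : dot (A *m usubmx w - b) (A *m usubmx v) + mu * dsubmx v 0 0 = - d.
  by rewrite /d dotC -opprB dotNr; ring.
have : g = g / d * d by rewrite divfK// gt_eqF.
move: (g / d) gd0 e1 => q q0 e1 -> le0.
have eq1 : e * q < 1 by nra.
have : 0 < e * d * (1 - e * q) by rewrite !mulr_gt0// subr_gt0.
lra.
Qed.

Definition piece (J : {set 'I_k}) : set R :=
  [set mu | 0 <= mu /\ exists w, kkt J mu w].

Lemma piece_is_interval J : is_interval (piece J).
Proof.
move=> s t [s0 [v [Cv Jv Hv]]] [t0 [w [Cw Jw Hw]]] u /andP[su ut].
split; first exact: le_trans su.
have [E|ts] := eqVneq s t.
  have -> : u = s by apply/eqP; rewrite eq_le su E ut.
  by exists v.
have st : 0 < t - s.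
  by rewrite subr_gt0 lt_neqAle ts (le_trans su ut).
pose a := (t - u) / (t - s); pose a' := (u - s) / (t - s).
have a0 : 0 <= a by rewrite divr_ge0 ?(ltW st)// subr_ge0.
have a0' : 0 <= a' by rewrite divr_ge0 ?(ltW st)// subr_ge0.
have aa : a + a' = 1 by rewrite /a /a'; field; rewrite gt_eqF.
have uE : u = a * s + a' * t by rewrite /a /a'; field; rewrite gt_eqF.
have CE i : (C *m (a *: v + a' *: w)) i 0 = a * (C *m v) i 0 + a' * (C *m w) i 0.
  by rewrite mulmxDr -!scalemxAr !mxE.
exists (a *: v + a' *: w); split.
- by move=> i; rewrite CE; have := Cv i; have := Cw i; nra.
- by move=> i iJ; rewrite CE Jv// Jw// !mulr0 addr0.
move=> z Cz; have := Hv z Cz; have := Hw z Cz.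
have -> : A *m usubmx (a *: v + a' *: w) =
    a *: (A *m usubmx v) + a' *: (A *m usubmx w).
  by rewrite linearD /= linearZ /= linearZ /= mulmxDr -!scalemxAr.
rewrite !dotBr dotDr !dotZr.
set p := dot _ b.
have : p = a * p + a' * p by rewrite -mulrDl aa mul1r.
rewrite uE; nra.
Qed.

(* Complementarity holds for all pairs of points of a piece, so that an affine
   relation between parameters is orthogonal to, hence carried over to, the
   residuals. *)
Lemma piece_collinear J s t u : piece J s -> piece J t -> piece J u ->
  (t - u) *: xi A b kappa s + (u - s) *: xi A b kappa t
    + (s - t) *: xi A b kappa u = 0.
Proof.
move=> [s0 [v Kv]] [t0 [w Kw]] [u0 [z Kz]].
rewrite (saddle_xi hkappa (kkt_saddle s0 Kv)).
rewrite (saddle_xi hkappa (kkt_saddle t0 Kw)).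
rewrite (saddle_xi hkappa (kkt_saddle u0 Kz)).
have := kkt_complementary Kv Kv; have := kkt_complementary Kv Kw.
have := kkt_complementary Kv Kz; have := kkt_complementary Kw Kv.
have := kkt_complementary Kw Kw; have := kkt_complementary Kw Kz.
have := kkt_complementary Kz Kv; have := kkt_complementary Kz Kw.
have := kkt_complementary Kz Kz.
move: (A *m usubmx v) (A *m usubmx w) (A *m usubmx z) => v1 w1 z1.
move: (dsubmx v 0 0) (dsubmx w 0 0) (dsubmx z 0 0) => v2 w2 z2.
move=> zz wz vz zw ww vw zv wv vv.
set d := (X in X = 0).
(* The coefficients sum to 0, so [b] cancels. In the product of both forms of [d] every term is a
   parameter times a height, and the weighted sum of the parameters vanishes. *)
have dE : d = - ((t - u) *: v1 + (u - s) *: w1 + (s - t) *: z1).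
  by apply/matrixP => i j; rewrite !mxE; ring.
apply: dot_eq0; rewrite {1}dE /d !dotNl !dotDl !dotZl !dotDr !dotZr.
rewrite zz wz vz zw ww vw zv wv vv le_eqVlt; apply/orP; left; apply/eqP; ring.
Qed.

(** Two distinct parameters determine the line, and [piece_collinear] puts all other residuals on
    it; a piece with at most one parameter is treated apart. *)
Lemma piece_affine J : affine_on (piece J) (xi A b kappa).
Proof.
have [[s [t [sJ tJ st]]]|same] :=
    pselect (exists s t, [/\ piece J s, piece J t & s != t]).
  pose q := (t - s)^-1 *: (xi A b kappa t - xi A b kappa s).
  exists (xi A b kappa s - s *: q), q => u uJ.
  have ts : t - s != 0 by rewrite subr_eq0 eq_sym.
  apply: (scalerI ts); have := piece_collinear sJ tJ uJ.
  have qE : (t - s) *: q = xi A b kappa t - xi A b kappa s.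
    by rewrite scalerA divff// scale1r.
  move: (xi _ _ _ s) (xi _ _ _ t) (xi _ _ _ u) q qE => xs xt xu q qE H.
  apply/matrixP => i j; have /matrixP/(_ i j) := H.
  have /matrixP/(_ i j) := qE; rewrite !mxE => qij Hij.
  have -> : (t - s) * (xs i j - s * q i j + u * q i j) =
      (t - s) * xs i j + (u - s) * ((t - s) * q i j) by ring.
  rewrite qij; lra.
have [[s sJ]|none] := pselect (exists s, piece J s).
  exists (xi A b kappa s), 0 => u uJ; rewrite scaler0 addr0.
  congr xi; apply/eqP/negPn/negP => us; apply: same.
  by exists u, s.
by exists 0, 0 => u uJ; exfalso; apply: none; exists u.
Qed.

(** * Existence of KKT points and continuity of the residual in [mu] *)

Lemma saddle_exists mu : 0 <= mu -> exists x t, saddle A b kappa mu x t.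
Proof.
move=> mu0; have [J [w K]] := kkt_exists mu0.
by exists (usubmx w), (dsubmx w 0 0); apply: kkt_saddle K.
Qed.

Lemma xi_holder : exists2 M, 0 <= M & forall s t, 0 <= s -> 0 <= t ->
  dot (xi A b kappa s - xi A b kappa t) (xi A b kappa s - xi A b kappa t)
    <= M * `|s - t|.
Proof.
have [x0 [t0 sad0]] := saddle_exists (lexx 0).
have [xt0 _ _] := sad0; have t00 := gauge_le_ge0 hkappa xt0.
exists t0 => // s t s0 t_ge0.
(* Heights decrease in the parameter, so [t0] bounds them. At [u = 0] the point [x0] itself is
   taken, since monotonicity compares distinct parameters only. *)
have bounded u : 0 <= u -> exists x r, saddle A b kappa u x r /\ 0 <= r <= t0.
  rewrite le_eqVlt => /predU1P[<-|u0]; first by exists x0, t0; rewrite t00 lexx.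
  have [x [r sad]] := saddle_exists (ltW u0); exists x, r; split=> //.
  rewrite (saddle_antitone hkappa sad0 sad u0) andbT.
  by have [xr _ _] := sad; apply: gauge_le_ge0 xr.
have [x [r [sad /andP[r0 rt]]]] := bounded _ s0.
have [x' [r' [sad' /andP[r0' rt']]]] := bounded _ t_ge0.
apply: le_trans (saddle_residual_dist hkappa sad sad') _.
apply: le_trans (ler_norm _) _; rewrite normrM mulrC ler_wpM2r//.
by rewrite ler_norml; apply/andP; split; lra.
Qed.

Lemma xi_continuous : {within `[0, +oo[, continuous (xi A b kappa)}.
Proof.
apply/subspace_continuousP => t; rewrite /= in_itv /= andbT => t0.
have [M M0 holder] := xi_holder.
apply/cvgrPdist_le => e e0.
(* The radius makes [M * |s - t| <= e ^+ 2]; adding 1 covers [M = 0]. *)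
rewrite near_withinE; apply/nbhs_ballP; exists (e ^+ 2 / (M + 1)).
  by rewrite /= divr_gt0 ?exprn_gt0// ltr_wpDl.
move=> s /= /ltW ts; rewrite in_itv /= andbT => s0.
have H := holder _ _ t0 s0.
(* A nonzero sup norm is attained at a coordinate, which the Euclidean norm bounds. *)
rewrite [leLHS]/Num.norm /=; have [->|/mx_norm_neq0[i ->]] :=
  eqVneq (mx_norm (xi A b kappa t - xi A b kappa s)) 0; first exact: ltW.
rewrite -ler_sqr ?nnegrE ?(ltW e0)// real_normK ?num_real// (ord1 i.2).
apply: le_trans (sqr_coord_le_dot _ _) (le_trans H _).
rewrite ler_pdivlMr ?ltr_wpDl// in ts.
by have := normr_ge0 (t - s); nra.
Qed.

Lemma xi_piecewise_affine : piecewise_affine `[0, +oo[ (xi A b kappa).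
Proof.
(* [Rhull] turns a piece, known to be convex, into an element of the type of intervals. *)
have pieceE J : [set` Rhull (piece J)] = piece J.
  by rewrite -((is_intervalP _).1 (@piece_is_interval J)).
split; first exact: xi_continuous.
exists [seq Rhull (piece J) | J : {set 'I_k}]; split.
  apply/seteqP; split=> t.
    rewrite /= in_itv /= andbT => t0; have [J [w K]] := kkt_exists t0.
    exists (Rhull (piece J)).
      by rewrite /=; apply/mapP; exists J; rewrite ?mem_enum.
    by rewrite pieceE; split=> //; exists w.
  case=> I /= /mapP[J _ ->]; rewrite -/([set` Rhull (piece J)] t) pieceE.
  by case=> t0 _; rewrite in_itv /= andbT.
by move=> I /mapP[J _ ->]; rewrite pieceE; apply: piece_affine.
Qed.

End pieces.

Theorem proposition1 (R : realType) (m n : nat)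
    (A : 'M[R]_(m, n)) (b : 'cV[R]_m) (kappa : 'cV[R]_n -> \bar R)
    (hkappa : polyhedral_gauge kappa) :
  (* domain of Omega and xi; uniqueness of the dual solution *)
  (forall mu : R, 0 <= mu ->
     Omega A b kappa mu !=set0 /\
     dual_solutions A b kappa mu = [set xi A b kappa mu]) /\
  (* (i) *)
  (forall mu : R, 0 <= mu ->
     (forall x, Omega A b kappa mu x -> xi A b kappa mu = b - A *m x) /\
     (forall x y, Omega A b kappa mu x -> Omega A b kappa mu y ->
        enorm (b - A *m x) = enorm (b - A *m y))) /\
  (* (ii) *)
  (forall mu : R, (mu_infty A b kappa <= mu%:E)%E ->
     xi A b kappa mu = b /\ Omega A b kappa mu 0) /\
  (* (iii) *)
  piecewise_affine `[0, +oo[ (xi A b kappa) /\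
  (* (iv) *)
  ((0 < mu_infty A b kappa)%E -> (mu_infty A b kappa < +oo)%E ->
   forall mu1 mu2 : R,
     0 <= mu1 -> mu1 < mu2 -> (mu2%:E <= mu_infty A b kappa)%E ->
     enorm (xi A b kappa mu1) < enorm (xi A b kappa mu2) /\
     (forall x1 x2, Omega A b kappa mu1 x1 -> Omega A b kappa mu2 x2 ->
        enorm (b - A *m x1) < enorm (b - A *m x2))).

Proof.
have [k [C epiC]] := epigraph_cone hkappa.
have sadE mu := saddle_exists A b hkappa epiC (mu := mu).
have OmegaE mu x : 0 <= mu -> Omega A b kappa mu x ->
    exists t, saddle A b kappa mu x t.
  by move=> /sadE[x0 [t0 sad0]]; apply: Omega_saddle sad0.
have xiE mu x : 0 <= mu -> Omega A b kappa mu x -> xi A b kappa mu = b - A *m x.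
  by move=> mu0 /(OmegaE _ _ mu0)[t /(saddle_xi hkappa)].
split=> [mu mu0|].
  have [x [t sad]] := sadE _ mu0.
  rewrite (saddle_xi hkappa sad) (saddle_dual_solutions hkappa sad).
  by split=> //; exists x; apply: saddle_Omega sad.
split=> [mu mu0|].
  split=> [x|x y xO yO]; first exact: xiE.
  by rewrite -(xiE _ _ mu0 xO) -(xiE _ _ mu0 yO).
split=> [mu bfeas|].
  (* At the origin the residual is [b], whose feasibility is the hypothesis on [mu]. *)
  have sad : saddle A b kappa mu 0 0.
    by rewrite /saddle gauge0// mulmx0 subr0 dot0l mulr0.
  rewrite (saddle_xi hkappa sad) mulmx0 subr0; split=> //.
  exact: saddle_Omega sad.
split; first exact: xi_piecewise_affine epiC.
move=> _ oofin mu1 mu2 mu1_ge0 mu12 mu2oo.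
have mu2_ge0 : 0 <= mu2 by rewrite (le_trans mu1_ge0)// ltW.
have norm_lt x1 x2 : Omega A b kappa mu1 x1 -> Omega A b kappa mu2 x2 ->
    enorm (b - A *m x1) < enorm (b - A *m x2).
  move=> /(OmegaE _ _ mu1_ge0)[t1 sad1] /(OmegaE _ _ mu2_ge0)[t2 sad2].
  exact: (saddle_norm_lt hkappa sad1 sad2).
split=> //.
have [x1 [t1 sad1]] := sadE _ mu1_ge0; have [x2 [t2 sad2]] := sadE _ mu2_ge0.
rewrite (saddle_xi hkappa sad1) (saddle_xi hkappa sad2).
exact: (saddle_norm_lt hkappa sad1 sad2).
Qed.
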